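(* Let $D_{(=,\geq)}(x)$ be the generating function, with respect to the length, for the total number of descents over all Catalan words avoiding the ordered pair of relations $(=,\geq)$. Then $$D_{(=,\geq)}(x)=\frac{1 - 2 x - 3 x^2 + x^4 -(1-x-x^2) \sqrt{1 - 2 x - 5 x^2 - 2 x^3 + x^4}}{2 x\sqrt{1 - 2 x - 5 x^2 - 2 x^3 + x^4}}.$$
   Context: A Catalan word of length $n$ is a word $w=w_1w_2\cdots w_n$ over the non-negative integers with $w_1=0$ and $0\leq w_i\leq w_{i-1}+1$ for $i=2,\dots,n$; the empty word is the unique Catalan word of length $0$. For relations $X,Y\in\{<,>,\leq,\geq,=,\neq\}$, a word $w$ contains the pattern $(X,Y)$ if there is an index $i\geq 1$ (with $i+2\le n$) such that $w_i\,X\,w_{i+1}$ and $w_{i+1}\,Y\,w_{i+2}$; otherwise $w$ avoids $(X,Y)$. The number of descents $\mathrm{des}(w)$ is the number of indices $i$ with $w_i>w_{i+1}$. With $C_{(X,Y)}(x,y)=\sum_{w}x^{|w|}y^{\mathrm{des}(w)}$, the sum being over all Catalan words $w$ (of any length $|w|\ge 0$) avoiding $(X,Y)$, one sets $D_{(X,Y)}(x)=\left.\frac{\partial C_{(X,Y)}(x,y)}{\partial y}\right|_{y=1}=\sum_w \mathrm{des}(w)\,x^{|w|}$. Identities are between formal power series in $x$ (after clearing denominators); the square root of a power series with constant term $1$ is the one with constant term $1$. *)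

(* Defs.v *)
From HB Require Import structures.
From mathcomp Require Import all_boot all_order all_algebra.
From mathcomp Require Import boolp classical_sets.

Set Implicit Arguments.
Unset Strict Implicit.
Unset Printing Implicit Defensive.

Import Order.TTheory GRing.Theory Num.Theory.
Local Open Scope ring_scope.

(** * Catalan words *)

Definition catalan (w : seq nat) : bool :=
  (nth 0%N w 0 == 0%N) && sorted (fun a b => (b <= a.+1)%N) w.

(* Positions are counted from 0. *)
Definition contains (X Y : rel nat) (w : seq nat) : bool :=
  has (fun i => X (nth 0%N w i) (nth 0%N w i.+1)
                && Y (nth 0%N w i.+1) (nth 0%N w i.+2))
      (iota 0 (size w - 2)).

Definition avoids (X Y : rel nat) (w : seq nat) : bool := ~~ contains X Y w.

Definition des (w : seq nat) : nat :=
  count (fun i => nth 0%N w i > nth 0%N w i.+1)%N (iota 0 (size w - 1)).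

(* The letters of a Catalan word of length n are all smaller than n (see
   [catalan_all_ltn] and [catalan_wordP]), so such words can be enumerated as
   tuples over 'I_n. *)
Definition word (n : nat) (t : n.-tuple 'I_n) : seq nat := map val t.

Lemma catalan_all_ltn (w : seq nat) :
  catalan w -> all (fun a => a < size w)%N w.
Proof.
case: w => [//|a w]; rewrite /catalan => /andP[/eqP/= -> pw].
suff H b v k : (b < k)%N -> path (fun a b => (b <= a.+1)%N) b v ->
    all (fun c => c < k + size v)%N v.
  by rewrite ltn0Sn -add1n; exact: H pw.
elim: v b k => [//|c v IH] b k bk /= /andP[cb pv].
have ck : (c < k.+1)%N by rewrite ltnS (leq_trans cb).
rewrite addnS -addSn (leq_trans ck) ?leq_addr //=.
exact: IH ck pv.
Qed.

Lemma word_inj (n : nat) : injective (@word n).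
Proof. by move=> s t /(inj_map val_inj)/val_inj. Qed.

Lemma catalan_wordP (n : nat) (w : seq nat) :
  catalan w -> size w = n -> exists t : n.-tuple 'I_n, word t = w.
Proof.
move=> /catalan_all_ltn wn sw; rewrite sw in wn.
have sz : size (pmap (insub : nat -> option 'I_n) w) == n.
  by rewrite size_pmap_sub -[X in _ == X]sw -all_count.
exists (Tuple sz); rewrite /word /=.
elim: w wn {sw sz} => [//|a w IH] /= /andP[an wn].
by rewrite insubT /= IH.
Qed.

(** * Formal power series *)

Record fps (R : Type) := FPS { fps_coef :> nat -> R }.

Lemma fpsP (R : Type) (f g : fps R) : f =1 g -> f = g.
Proof. by case: f g => [f] [g] /= /funext ->. Qed.

HB.instance Definition _ (R : Type) := gen_eqMixin (fps R).
HB.instance Definition _ (R : Type) := gen_choiceMixin (fps R).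

Section FpsRing.
Variable R : comNzRingType.
Implicit Types f g h : fps R.

Definition fps_zero : fps R := FPS (fun=> 0).
Definition fps_opp f : fps R := FPS (fun n => - f n).
Definition fps_add f g : fps R := FPS (fun n => f n + g n).
Definition fps_one : fps R := FPS (fun n => (n == 0%N)%:R).
Definition fps_mul f g : fps R :=
  FPS (fun n => \sum_(i < n.+1) f i * g (n - i)%N).

Lemma fps_addA : associative fps_add.
Proof. by move=> f g h; apply: fpsP => n /=; rewrite addrA. Qed.
Lemma fps_addC : commutative fps_add.
Proof. by move=> f g; apply: fpsP => n /=; rewrite addrC. Qed.
Lemma fps_add0 : left_id fps_zero fps_add.
Proof. by move=> f; apply: fpsP => n /=; rewrite add0r. Qed.
Lemma fps_addN : left_inverse fps_zero fps_opp fps_add.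
Proof. by move=> f; apply: fpsP => n /=; rewrite addNr. Qed.

HB.instance Definition _ :=
  GRing.isZmodule.Build (fps R) fps_addA fps_addC fps_add0 fps_addN.

Definition fps_trunc (m : nat) f : {poly R} := \poly_(i < m.+1) f i.

Lemma coef_fps_trunc m f n : (n <= m)%N -> (fps_trunc m f)`_n = f n.
Proof. by move=> nm; rewrite coef_poly ltnS nm. Qed.

Lemma fps_mul_trunc m f g n : (n <= m)%N ->
  fps_mul f g n = (fps_trunc m f * fps_trunc m g)`_n.
Proof.
move=> nm; rewrite coefM; apply: eq_bigr => i _.
rewrite !coef_fps_trunc ?(leq_trans (leq_subr _ _)) //.
by rewrite (leq_trans _ nm) // -ltnS.
Qed.

Lemma fps_mulC : commutative fps_mul.
Proof.
by move=> f g; apply: fpsP => n; rewrite !(@fps_mul_trunc n) // mulrC.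
Qed.

Lemma fps_mulA : associative fps_mul.
Proof.
move=> f g h; apply: fpsP => n.
transitivity (fps_trunc n f * (fps_trunc n g * fps_trunc n h))`_n.
  rewrite coefM; apply: eq_bigr => i _.
  by rewrite -fps_mul_trunc ?leq_subr // coef_fps_trunc // -ltnS.
rewrite mulrA coefM; apply: eq_bigr => i _.
have le_in : (i <= n)%N by rewrite -ltnS.
by rewrite -(fps_mul_trunc f g le_in) coef_fps_trunc // leq_subr.
Qed.

Lemma fps_mul1 : left_id fps_one fps_mul.
Proof.
move=> f; apply: fpsP => n /=.
rewrite big_ord_recl /= mul1r subn0 big1 ?addr0 // => i _.
by rewrite mul0r.
Qed.

Lemma fps_mulDl : left_distributive fps_mul fps_add.
Proof.
move=> f g h; apply: fpsP => n /=; rewrite -big_split /=.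
by apply: eq_bigr => i _; rewrite mulrDl.
Qed.

Lemma fps_one_neq0 : fps_one != 0.
Proof.
apply/eqP => /(congr1 (fun f : fps R => f 0%N)) /= /eqP.
by rewrite oner_eq0.
Qed.

HB.instance Definition _ :=
  GRing.Zmodule_isComNzRing.Build (fps R)
    fps_mulA fps_mulC fps_mul1 fps_mulDl fps_one_neq0.

Definition fpsX : fps R := FPS (fun n => (n == 1%N)%:R).

Lemma fps_coef0 n : (0 : fps R) n = 0. Proof. by []. Qed.
Lemma fps_coef1 n : (1 : fps R) n = (n == 0%N)%:R. Proof. by []. Qed.
Lemma fps_coefD f g n : (f + g) n = f n + g n. Proof. by []. Qed.
Lemma fps_coefN f n : (- f) n = - f n. Proof. by []. Qed.
Lemma fps_coefM f g n : (f * g) n = \sum_(i < n.+1) f i * g (n - i)%N.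
Proof. by []. Qed.
Lemma fps_coefX n : fpsX n = (n == 1%N)%:R. Proof. by []. Qed.

End FpsRing.

(* The square root with constant term 1; it exists and is unique as soon as
   p has constant term 1 (lemmas [fps_sqrtP] and [fps_sqrt_unique]). *)
Definition fps_sqrt (p : fps rat) : fps rat :=
  xget 0 [set s : fps rat | s 0%N = 1 /\ s ^+ 2 = p]%classic.

Section FpsSqrt.
Variable p : fps rat.

Fixpoint sqrt_prefix (n : nat) : seq rat :=
  if n is m.+1 then
    let s := sqrt_prefix m in
    rcons s (if m == 0%N then 1 else
      (p m - \sum_(i < m.-1) s`_i.+1 * s`_(m - i.+1)) / 2%:R)
  else [::].

Lemma size_sqrt_prefix n : size (sqrt_prefix n) = n.
Proof. by elim: n => //= n IH; rewrite size_rcons IH. Qed.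

Definition sqrt_coef (n : nat) : rat := (sqrt_prefix n.+1)`_n.

Lemma nth_sqrt_prefix n i : (i < n)%N -> (sqrt_prefix n)`_i = sqrt_coef i.
Proof.
elim: n => // n IH; rewrite ltnS leq_eqVlt => /predU1P[->//|lt_in].
by rewrite /= nth_rcons size_sqrt_prefix lt_in IH.
Qed.

Lemma sqrt_coefS n : sqrt_coef n.+1 =
  (p n.+1 - \sum_(i < n) sqrt_coef i.+1 * sqrt_coef (n - i)%N) / 2%:R.
Proof.
rewrite {1}/sqrt_coef /sqrt_prefix -/(sqrt_prefix n.+1) nth_rcons.
rewrite size_sqrt_prefix ltnn eqxx; congr ((_ - _) / _).
apply: eq_bigr => i _.
by rewrite !nth_sqrt_prefix ?subSS ?ltnS ?leq_subr // ltn_ord.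
Qed.

Lemma fps_sqr_coefS (s : fps rat) n : s 0%N = 1 ->
  (s ^+ 2) n.+1 = 2%:R * s n.+1 + \sum_(i < n) s i.+1 * s (n - i)%N.
Proof.
move=> s0; rewrite expr2 fps_coefM big_ord_recl big_ord_recr /=.
rewrite /bump /= !add1n subnn subn0 s0 mul1r mulr1 mulr_natl mulr2n.
by rewrite -addrA; congr (_ + _); rewrite addrC; congr (_ + _).
Qed.

Lemma fps_sqrt_unique (s t : fps rat) :
  s 0%N = 1 -> s ^+ 2 = p -> t 0%N = 1 -> t ^+ 2 = p -> s = t.
Proof.
move=> s0 s2 t0 t2; apply: fpsP => n.
have [m] := ubnP n; elim: m n => // m IH [|n] nm; first by rewrite s0 t0.
have: (s ^+ 2) n.+1 = (t ^+ 2) n.+1 by rewrite s2 t2.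
rewrite !fps_sqr_coefS //.
have -> : \sum_(i < n) s i.+1 * s (n - i)%N
        = \sum_(i < n) t i.+1 * t (n - i)%N.
  apply: eq_bigr => i _; congr (_ * _); apply: IH.
    by rewrite (leq_ltn_trans (ltn_ord i)).
  by rewrite (leq_ltn_trans (leq_subr _ _)).
by move=> /addIr; apply: mulfI; rewrite pnatr_eq0.
Qed.

Lemma fps_sqrtP : p 0%N = 1 -> fps_sqrt p 0%N = 1 /\ fps_sqrt p ^+ 2 = p.
Proof.
move=> p0; rewrite /fps_sqrt.
apply: (@xgetPex _ 0 [set s : fps rat | s 0%N = 1 /\ s ^+ 2 = p]%classic).
exists (FPS sqrt_coef); split => //; apply: fpsP => -[|n].
  by rewrite expr2 fps_coefM big_ord1 p0.
by rewrite fps_sqr_coefS //= sqrt_coefS mulrC divfK ?subrK // pnatr_eq0.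
Qed.

End FpsSqrt.

(** * Generating functions *)

(* A bivariate series in x and y with finitely many powers of y in each
   x-degree: the coefficient of x^n is a polynomial in y. *)
Definition catalan_gf (X Y : rel nat) : fps {poly rat} :=
  FPS (fun n => \sum_(t : n.-tuple 'I_n | catalan (word t) && avoids X Y (word t))
                  'X^(des (word t))).

Definition descent_gf (X Y : rel nat) : fps rat :=
  FPS (fun n => (catalan_gf X Y n)^`().[1]).

Lemma descent_gfE (X Y : rel nat) (n : nat) :
  descent_gf X Y n =
  \sum_(t : n.-tuple 'I_n | catalan (word t) && avoids X Y (word t))
     (des (word t))%:R.
Proof.
rewrite /= raddf_sum /= horner_sum; apply: eq_bigr => t _.
by rewrite derivXn hornerMn hornerXn expr1n.
Qed.

(* Main.v *)
Require Import Defs.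
From mathcomp Require Import all_boot all_order all_algebra.
From mathcomp Require Import ring.
Local Open Scope ring_scope.

Set Implicit Arguments.
Unset Strict Implicit.
Unset Printing Implicit Defensive.

Import GRing.Theory.

(** A non-empty Catalan word factors uniquely as [0 (u+1) v] with [u], [v]
    Catalan, and it avoids [(=, >=)] iff [u] and [v] do, [u] does not end in a
    repeated letter when [v] is non-empty, and [v] does not start with a
    repeated letter when [u] is empty; a descent is created at the junction iff
    both factors are non-empty.  Repeating the last (or first) letter shows that
    the non-empty avoiders without a final (or initial) repetition have series
    [N / (1 + x)], where [N] counts all non-empty avoiders.  Hence, for the
    counting series [N] and the descent series [D],
    [x N^2 - (1 - x - x^2) N + x + x^2 = 0] and
    [(1 - x - x^2 - 2 x N) D = x N^2], and the factor of [D] in the second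
    identity is the square root of the discriminant of the first. *)

(** * Decomposition of Catalan words at their second zero *)

Definition catalan_words (n : nat) : seq (seq nat) :=
  [seq w <- [seq word t | t <- enum {: n.-tuple 'I_n}] | catalan w].

Lemma catalan_words_uniq (n : nat) : uniq (catalan_words n).
Proof.
by rewrite filter_uniq // map_inj_uniq ?enum_uniq //; apply: word_inj.
Qed.

Lemma mem_catalan_words (n : nat) (w : seq nat) :
  (w \in catalan_words n) = catalan w && (size w == n).
Proof.
rewrite mem_filter; case cw: (catalan w) => //=.
apply/mapP/eqP => [[t _ ->]|sw]; first by rewrite size_map size_tuple.
by have [t <-] := catalan_wordP cw sw; exists t; rewrite ?mem_enum.
Qed.

Lemma catalan_head (w : seq nat) : catalan w -> nth 0%N w 0 = 0%N.
Proof. by case/andP=> /eqP. Qed.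

Definition glue (u v : seq nat) : seq nat := 0%N :: map S u ++ v.

(** The letters of [map S u] are positive and [v] is empty or starts with 0, so the cut is found at
    the first zero after the leading one. The default value of [nth] lets one hypothesis cover empty
    [v]. *)
Lemma glue_inj (u v u' v' : seq nat) :
  nth 0%N v 0 = 0%N -> nth 0%N v' 0 = 0%N ->
  glue u v = glue u' v' -> u = u' /\ v = v'.
Proof.
move=> v0 v0' []; elim: u u' => [|a u IH] [|a' u'] //=.
- by move=> ev; rewrite ev in v0.
- by move=> ev; rewrite -ev in v0'.
- by case=> -> /IH[-> ->].
Qed.

(** The drop to 0 at the junction is always allowed, and the step from the leading 0 to the first
    letter of [map S u] forces [u] to start with 0. *)
Lemma catalan_glue (u v : seq nat) :
  nth 0%N v 0 = 0%N -> catalan (glue u v) = catalan u && catalan v.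
Proof.
rewrite /catalan => v0; rewrite v0 eqxx /= cat_path.
case: u => [|a u] /=; first by case: v v0 => [|b v] //= ->.
rewrite path_map ltnS leqn0 -!andbA.
case: (a == 0%N) => //=; congr (_ && _).
by case: v v0 => [|b v] //= ->.
Qed.

Lemma glue_surj (w : seq nat) : catalan w -> w != [::] ->
  exists u v, [/\ w = glue u v, catalan u & catalan v].
Proof.
case: w => [//|a t] cw _; move: (catalan_head cw) => /= a0; subst a.
have [u [v [tE v0]]] : exists u v, t = map S u ++ v /\ nth 0%N v 0 = 0%N.
  (* A letter 0 ends the shifted factor, so everything from it on becomes [v]; a positive letter is
     put in front of [u]. *)
  elim: t {cw} => [|[|a] t [u [v [-> v0]]]]; first by exists [::], [::].
    by exists [::], (0%N :: map S u ++ v).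
  by exists (a :: u), v.
move: cw; rewrite tE -/(glue u v) catalan_glue // => /andP[cu cv].
by exists u, v.
Qed.

Lemma perm_catalan_words_glue (n : nat) :
  perm_eq (catalan_words n.+1)
    [seq glue p.1 p.2 | i <- iota 0 n.+1,
       p <- [seq (u, v) | u <- catalan_words i, v <- catalan_words (n - i)]].
Proof.
have pP i p :
    p \in [seq (u, v) | u <- catalan_words i, v <- catalan_words (n - i)] ->
    [/\ catalan p.1, size p.1 = i, catalan p.2 & size p.2 = n - i]%N.
  case/allpairsP=> -[u v] [/=]; rewrite !mem_catalan_words.
  by move=> /andP[cu /eqP su] /andP[cv /eqP sv] ->.
apply: uniq_perm; first exact: catalan_words_uniq.
  pose gl (i : nat) p := glue p.1 p.2.
  apply: (@allpairs_uniq_dep _ (fun=> (seq nat * seq nat)%type) _ gl).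
    exact: iota_uniq.
    move=> i _; apply: allpairs_uniq; rewrite ?catalan_words_uniq //.
    by move=> [u v] [u' v'].
  (* The index of the block is recovered as the length of [u], so distinct blocks are disjoint. *)
  move=> x y /allpairsPdep[i [p [_ /pP[_ si /catalan_head v0 _] ->]]].
  move=> /allpairsPdep[j [q [_ /pP[_ sj /catalan_head v0' _] ->]]] /=.
  case: p q si sj v0 v0' => [u v] [u' v'] /= <- <- v0 v0'.
  by case/(glue_inj v0 v0') => /= <- <-.
move=> w; rewrite mem_catalan_words; apply/andP/allpairsPdep.
  case=> cw /eqP sw; have [|u [v [wE cu cv]]] := glue_surj cw.
    by rewrite -size_eq0 sw.
  have sn : (size u + size v = n)%N.
    by move: sw; rewrite wE /= size_cat size_map => -[].
  exists (size u), (u, v); split=> //.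
    by rewrite mem_iota /= add0n ltnS -sn leq_addr.
  by apply: allpairs_f; rewrite mem_catalan_words ?cu ?cv //= -sn addKn.
case=> i [p [ilt /pP[cu su cv sv] ->]].
rewrite catalan_glue ?catalan_head // cu cv /= size_cat size_map su sv.
by rewrite subnKC //; move: ilt; rewrite mem_iota.
Qed.

Lemma catalan_words0 : catalan_words 0 = [:: [::]].
Proof.
have: perm_eq (catalan_words 0) [:: [::]]; last by move/perm_small_eq->.
apply: uniq_perm => [||w]; rewrite ?catalan_words_uniq // mem_catalan_words inE.
by rewrite size_eq0; case: eqP => [->|]; rewrite ?andbF.
Qed.

(** * Weighted generating series of Catalan words *)

Section WordSeries.
Variable R : comNzRingType.
Implicit Types f g h : seq nat -> R.

Definition word_gf f : fps R := FPS (fun n => \sum_(w <- catalan_words n) f w).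

Lemma eq_word_gf f g :
  (forall w, catalan w -> f w = g w) -> word_gf f = word_gf g.
Proof.
move=> fg; apply: fpsP => n; apply: eq_big_seq => w.
by rewrite mem_catalan_words => /andP[/fg].
Qed.

Lemma word_gfD f g :
  word_gf (fun w => f w + g w) = word_gf f + word_gf g.
Proof. by apply: fpsP => n; rewrite /= big_split. Qed.

Lemma fps_mulX_coef0 (f : fps R) : (fpsX R * f) 0%N = 0.
Proof. by rewrite fps_coefM big_ord1 mul0r. Qed.

Lemma fps_mulX_coefS (f : fps R) n : (fpsX R * f) n.+1 = f n.
Proof.
rewrite fps_coefM !big_ord_recl /= mul0r add0r mul1r subSS subn0.
by rewrite big1 ?addr0 // => i _; rewrite mul0r.
Qed.

Lemma fps_coef_sum (I : Type) (r : seq I) (F : I -> fps R) n :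
  (\sum_(i <- r) F i) n = \sum_(i <- r) F i n.
Proof.
by elim: r => [|i r IH]; rewrite ?big_nil // !big_cons fps_coefD IH.
Qed.

(** Marks an empty factor, so that degenerate cases of the decomposition also take product form. *)
Definition nil_weight (w : seq nat) : R := (w == [::])%:R.

Lemma word_gf_nil : word_gf nil_weight = 1.
Proof.
apply: fpsP => -[|n]; first by rewrite /= catalan_words0 big_seq1.
rewrite /= big_seq big1 // => w; rewrite mem_catalan_words => /andP[_].
by case: w.
Qed.

(** The leading 0 gives the factor x, and summing over the length of [u] gives Cauchy products. A
    sum over [gs] is allowed because a weight splits differently according to which factors are
    empty. *)
Lemma word_gf_glue f (gs : seq ((seq nat -> R) * (seq nat -> R))) :
  f [::] = 0 ->
  (forall u v, catalan u -> catalan v ->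
     f (glue u v) = \sum_(g <- gs) g.1 u * g.2 v) ->
  word_gf f = fpsX R * \sum_(g <- gs) word_gf g.1 * word_gf g.2.
Proof.
move=> f0 fE; apply: fpsP => -[|n].
  by rewrite fps_mulX_coef0 /= catalan_words0 big_seq1.
rewrite fps_mulX_coefS fps_coef_sum.
under [RHS]eq_bigr => g _ do rewrite fps_coefM.
rewrite /= (perm_big _ (perm_catalan_words_glue n)) big_allpairs_dep.
rewrite exchange_big /= -(big_mkord xpredT (fun i => \sum_(g <- gs)
  word_gf g.1 i * word_gf g.2 (n - i)%N)) /index_iota subn0.
apply: eq_bigr => i _; rewrite big_allpairs /=.
under [RHS]eq_bigr => g _ do rewrite big_distrlr /=.
rewrite [RHS]exchange_big; apply: eq_big_seq => u.
rewrite mem_catalan_words => /andP[cu _].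
rewrite [RHS]exchange_big; apply: eq_big_seq => v.
by rewrite mem_catalan_words => /andP[cv _]; exact: fE.
Qed.

Definition dup_last (w : seq nat) : seq nat := rcons w (last 0%N w).

Fixpoint end_rep (w : seq nat) : bool :=
  if w is a :: t then (if t is [:: b] then a == b else end_rep t) else false.

Lemma end_rep_rcons2 (s : seq nat) a b :
  end_rep (rcons (rcons s a) b) = (a == b).
Proof.
elim: s => [//|c s IH]; rewrite -[RHS]IH !rcons_cons /=.
by case: s {IH} => [|d [|e s]].
Qed.

Lemma catalan_dup_last (w : seq nat) : catalan (dup_last w) = catalan w.
Proof.
case: w => [|a w] //=; rewrite /catalan /dup_last /= rcons_path leqnSn.
by rewrite andbT.
Qed.

Lemma dup_last_inj : injective dup_last.
Proof. by move=> u v /rcons_inj[]. Qed.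

(** [dup_last] is a bijection from non-empty Catalan words of length n to those of length n + 1 that
    end in a repetition. *)
Lemma word_gf_end_rep f :
  word_gf (fun w => if end_rep w then f w else 0)
  = fpsX R * word_gf (fun w => if w == [::] then 0 else f (dup_last w)).
Proof.
apply: fpsP => -[|n].
  by rewrite fps_mulX_coef0 /= catalan_words0 big_seq1.
rewrite fps_mulX_coefS /= -big_mkcond /=.
rewrite [RHS](eq_bigr (fun w => if w != [::] then f (dup_last w) else 0)); last first.
  by move=> w _; rewrite if_neg.
rewrite -big_mkcond /= -[LHS]big_filter -[RHS]big_filter.
rewrite -(big_map dup_last xpredT f); apply: perm_big; apply: uniq_perm.
- by rewrite filter_uniq ?catalan_words_uniq.
- by rewrite (map_inj_uniq dup_last_inj) filter_uniq ?catalan_words_uniq.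
move=> w; rewrite mem_filter mem_catalan_words; apply/idP/mapP.
  case/lastP: w => [//|w b]; case/lastP: w => [//|s a].
  rewrite end_rep_rcons2 => /and3P[/eqP <- cw sw].
  have dE : rcons (rcons s a) a = dup_last (rcons s a).
    by rewrite /dup_last last_rcons.
  exists (rcons s a); rewrite // mem_filter mem_catalan_words.
  rewrite -catalan_dup_last -dE cw; move: sw.
  by rewrite !size_rcons eqSS => ->; rewrite andbT; case: s {dE cw}.
case=> u; rewrite mem_filter mem_catalan_words => /and3P[u0 cu /eqP su] ->.
rewrite catalan_dup_last cu size_rcons su eqxx !andbT.
by case/lastP: u u0 {cu su} => [//|s a] _; rewrite /dup_last last_rcons
  end_rep_rcons2.
Qed.

End WordSeries.

(** * Descents and avoidance under gluing and repetition *)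

Lemma des_cons2 (a b : nat) (s : seq nat) :
  des [:: a, b & s] = ((b < a) + des (b :: s))%N.
Proof.
rewrite /des /= !subn1 /= -[1%N]addn0 iotaDl count_map.
by congr (_ + _)%N; apply: eq_count => i.
Qed.

Lemma avoids_cons3 (X Y : rel nat) (a b c : nat) (s : seq nat) :
  avoids X Y [:: a, b, c & s]
  = ~~ (X a b && Y b c) && avoids X Y [:: b, c & s].
Proof.
rewrite /avoids /contains /= !subn2 /= -negb_or; congr (~~ (_ || _)).
by rewrite -[1%N]addn0 iotaDl has_map; apply: eq_has => i.
Qed.

Notation av := (avoids (fun a b : nat => a == b) (fun a b : nat => (a >= b)%N)).

Definition start_rep (w : seq nat) : bool :=
  if w is [:: a, b & _] then a == b else false.

Lemma av_cons0 (v : seq nat) :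
  nth 0%N v 0 = 0%N -> av (0%N :: v) = ~~ start_rep v && av v.
Proof.
case: v => [|a [|b s]] //= ->; rewrite ?avoids_cons3 //.
by rewrite leqn0 eq_sym.
Qed.

Lemma des_cons0 (v : seq nat) : des (0%N :: v) = des v.
Proof. by case: v => [|a v] //; rewrite des_cons2. Qed.

Lemma des_map_succ (u : seq nat) : des (map S u) = des u.
Proof.
elim: u => [|a [|b u] IH] //.
by rewrite [LHS]des_cons2 des_cons2 -IH.
Qed.

Lemma av_map_succ (u : seq nat) : av (map S u) = av u.
Proof.
elim: u => [|a [|b [|c u]] IH] //.
by rewrite [LHS]avoids_cons3 avoids_cons3 -IH.
Qed.

(** The new first step is a strict rise, so no occurrence of the pattern starts there. *)
Lemma av_succ_cons (u : seq nat) : av (0%N :: map S u) = av u.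
Proof.
by rewrite -[RHS]av_map_succ; case: u => [|a [|b u]] //; rewrite avoids_cons3.
Qed.

Lemma des_glue (u t : seq nat) : u != [::] ->
  des (glue u (0%N :: t)) = (des u + des (0%N :: t)).+1.
Proof.
rewrite [LHS]des_cons0; elim: u => [//|a [|b u] IH] _; first by rewrite des_cons2.
by rewrite [LHS]des_cons2 [X in (_ + X)%N]IH // des_cons2 ltnS addnS addnA.
Qed.

(** Two windows can straddle the junction. The one ending at the new 0 is an occurrence exactly when
    the last two letters of [u] agree; the one whose middle letter is that 0 begins with a strict
    descent and is harmless. *)
Lemma av_glue (u t : seq nat) : u != [::] ->
  av (glue u (0%N :: t)) = [&& av u, ~~ end_rep u & av (0%N :: t)].
Proof.
move=> u0; have -> : av (glue u (0%N :: t)) = av (map S u ++ 0%N :: t).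
  by case: u u0 => [//|a [|b u]] _; rewrite /glue /= avoids_cons3.
elim: u u0 => [//|a [|b [|c u]] IH] _.
- by case: t {IH} => [|b t] //; rewrite /= avoids_cons3.
- rewrite [LHS]avoids_cons3 [X in _ && X]IH //= eqSS andbT.
  by [].
- by rewrite [LHS]avoids_cons3 [X in _ && X]IH // avoids_cons3 -andbA.
Qed.

(** The only new window has the form a b b, whose second relation always holds, so it is an
    occurrence exactly when a = b. *)
Lemma av_dup_last (w : seq nat) : w != [::] ->
  av (dup_last w) = av w && ~~ end_rep w.
Proof.
elim: w => [//|a [|b [|c w]] IH] _ //.
  by rewrite /dup_last /= avoids_cons3 leqnn andbT andbC.
by rewrite [LHS]avoids_cons3 [X in _ && X]IH // avoids_cons3 -andbA.
Qed.

Lemma des_dup_last (w : seq nat) : des (dup_last w) = des w.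
Proof.
elim: w => [//|a [|b w] IH] //; first by rewrite /dup_last /= des_cons2 ltnn.
by rewrite [LHS]des_cons2 [X in (_ + X)%N]IH des_cons2.
Qed.

(** * Series of avoiders weighted by a function of the descent number *)

Section AvoiderSeries.
Variable R : comNzRingType.
Implicit Types phi : nat -> R.

(** The constant [phi] equal to 1 counts avoiders, and the embedding of the naturals totals their
    descents; both are treated at once. *)
Definition av_weight phi (P : pred (seq nat)) (w : seq nat) : R :=
  if av w && P w then phi (des w) else 0.

Definition nonempty (w : seq nat) : bool := w != [::].
Definition open_end (w : seq nat) : bool := nonempty w && ~~ end_rep w.
Definition open_start (w : seq nat) : bool := nonempty w && ~~ start_rep w.

Definition av_gf phi (P : pred (seq nat)) : fps R := word_gf (av_weight phi P).

Lemma av_gf_open_end phi :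
  av_gf phi nonempty = (1 + fpsX R) * av_gf phi open_end.
Proof.
rewrite mulrDl mul1r -[fpsX R * _](_ : word_gf (fun w =>
  if end_rep w then av_weight phi nonempty w else 0) = _).
  rewrite -word_gfD; apply: eq_word_gf => w _; rewrite /av_weight /open_end.
  case: (boolP (end_rep w)) => ew; first by rewrite !andbF add0r.
  by rewrite andbT addr0.
rewrite word_gf_end_rep; congr (_ * _); apply: eq_word_gf => w _.
rewrite /av_weight /open_end /nonempty; case: eqP => [->//|/eqP w0].
by rewrite av_dup_last // des_dup_last -size_eq0 size_rcons /= andbT.
Qed.

Lemma av_gf_open_start phi :
  av_gf phi nonempty = (1 + fpsX R) * av_gf phi open_start.
Proof.
rewrite mulrDl mul1r -[fpsX R * _](_ : word_gf (fun w =>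
  if start_rep w then av_weight phi nonempty w else 0) = _).
  rewrite -word_gfD; apply: eq_word_gf => w _; rewrite /av_weight /open_start.
  case: (boolP (start_rep w)) => ew; first by rewrite !andbF add0r.
  by rewrite andbT addr0.
(* Words with an initial repetition are those with empty first factor and non-empty second
   factor. *)
rewrite (@word_gf_glue _ _ [:: (nil_weight R, av_weight phi open_start)]) //.
  by rewrite big_seq1 word_gf_nil mul1r.
move=> [|a u] v cu cv; rewrite big_seq1 /nil_weight /= ?mul0r ?mul1r //.
rewrite /av_weight /open_start av_cons0 ?catalan_head // des_cons0.
case: v cv => [|a v] /catalan_head //= ->.
by rewrite eqxx !andbT andbC.
Qed.

(** The four summands correspond to both factors empty, only [v] empty, only [u] empty, and neither
    empty. Only the last case adds a descent, whence the successor in the splitting hypothesis on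
    [phi]. *)
Lemma av_gf_nonempty phi (gs : seq ((nat -> R) * (nat -> R))) :
  (forall m n, phi (m + n).+1 = \sum_(g <- gs) g.1 m * g.2 n) ->
  av_gf phi nonempty =
    fpsX R * (word_gf (fun w => phi 0%N * nil_weight R w)
              + av_gf phi nonempty + av_gf phi open_start
              + \sum_(g <- gs) av_gf g.1 open_end * av_gf g.2 nonempty).
Proof.
move=> phiE; rewrite {1}/av_gf (@word_gf_glue _ _
  [:: (fun w => phi 0%N * nil_weight R w, nil_weight R),
      (av_weight phi nonempty, nil_weight R),
      (nil_weight R, av_weight phi open_start)
    & [seq (av_weight g.1 open_end, av_weight g.2 nonempty) | g <- gs]]) //.
  rewrite !big_cons big_map /= word_gf_nil !mulr1 mul1r.
  by rewrite !addrA.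
move=> u v cu cv; rewrite !big_cons big_map /= /nil_weight.
have [->|u0] := eqVneq u [::].
  rewrite [X in _ + (_ + (_ + X))]big1 ?mulr1 ?mul1r; last first.
    by move=> g _; rewrite mul0r.
  rewrite {1 2}/av_weight /= av_cons0 ?catalan_head // des_cons0 mul0r add0r.
  rewrite addr0 /av_weight /open_start.
  case: v cv => [|a v] cv; first by rewrite mulr1 addr0.
  by rewrite mulr0 add0r andbT andbC.
rewrite mulr0 !mul0r !add0r.
case: v cv => [|a v] cv.
  rewrite mulr1 big1 ?addr0; last by move=> g _; rewrite mulr0.
  rewrite /av_weight /glue cats0 av_succ_cons des_cons0 des_map_succ.
  by rewrite /nonempty u0.
rewrite mulr0 add0r; move/catalan_head: cv => /= ->.
rewrite /av_weight av_glue // des_glue // phiE /open_end /nonempty u0 !andbT /=.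
case: (av u); last by rewrite [RHS]big1 // => g _; rewrite mul0r.
case: (end_rep u); first by rewrite [RHS]big1 // => g _; rewrite mul0r.
by case: (av _) => //; rewrite [RHS]big1 // => g _; rewrite mulr0.
Qed.

End AvoiderSeries.

(** * Functional equations for the counting and descent series *)

Definition count_gf : fps rat := av_gf (fun=> 1) nonempty.

Lemma count_gf_eq :
  fpsX rat * count_gf ^+ 2
  = (1 - fpsX rat - fpsX rat ^+ 2) * count_gf - fpsX rat - fpsX rat ^+ 2.
Proof.
pose gs : seq ((nat -> rat) * (nat -> rat)) := [:: (fun=> 1, fun=> 1)].
have one_split m n : 1 = \sum_(g <- gs) g.1 m * g.2 n.
  by rewrite big_seq1 mul1r.
have := @av_gf_nonempty _ (fun=> 1) _ one_split; rewrite big_seq1 /=.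
rewrite (_ : word_gf _ = 1) -/count_gf; last first.
  by rewrite -[RHS]word_gf_nil; apply: eq_word_gf => w _; rewrite mul1r.
have U := av_gf_open_end (fun=> 1 : rat).
have V := av_gf_open_start (fun=> 1 : rat).
rewrite -/count_gf in U V.
set u := av_gf _ open_end in U *; set v := av_gf _ open_start in V *.
set x := fpsX rat in U V *; set N := count_gf in U V *.
move=> E.
(* Multiplying by 1 + x eliminates the auxiliary series [u] and [v] without any division. *)
have {}E : (1 + x) * N = x * ((1 + x) * (1 + N) + N + N * N).
  have -> : x * ((1 + x) * (1 + N) + N + N * N)
    = x * ((1 + x) * (1 + N) + (1 + x) * v + (1 + x) * u * N) by rewrite -V -U.
  by rewrite [in LHS]E; ring.
have -> : x * N ^+ 2 = x * ((1 + x) * (1 + N) + N + N * N)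
   - x * (1 + x) * (1 + N) - x * N by ring.
by rewrite -E; ring.
Qed.

Lemma descent_gf_av :
  descent_gf (fun a b : nat => a == b) (fun a b : nat => (a >= b)%N)
  = av_gf (fun n => n%:R) nonempty.
Proof.
apply: fpsP => n; rewrite descent_gfE /= /catalan_words big_filter big_map.
rewrite big_enum_cond /=.
rewrite [LHS]big_mkcondr /=; apply: eq_big => // t _.
(* The empty word has no descent, so excluding it changes nothing. *)
by rewrite /av_weight; case: (word t) => [|a w] /=; rewrite ?andbT.
Qed.

Lemma descent_gf_eq (D := av_gf (fun n => n%:R : rat) nonempty) :
  (1 - fpsX rat - fpsX rat ^+ 2 - 2 * fpsX rat * count_gf) * D
  = fpsX rat * count_gf ^+ 2.
Proof.
(* The splitting m + n + 1 = 1·1 + m·1 + 1·n: the junction's descent, those of [u], those of [v]. *)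
pose gs : seq ((nat -> rat) * (nat -> rat)) :=
  [:: (fun=> 1, fun=> 1); (fun n => n%:R, fun=> 1); (fun=> 1, fun n => n%:R)].
have succ_split m n : (m + n).+1%:R = \sum_(g <- gs) g.1 m * g.2 n.
  by rewrite !big_cons big_nil /= !mul1r mulr1 addr0 -natrD -natr1 addrC.
have := @av_gf_nonempty _ (fun n => n%:R) _ succ_split.
rewrite !big_cons big_nil addr0 /=.
rewrite (_ : word_gf _ = 0) -/count_gf -/D; last first.
  by apply: fpsP => n; rewrite /= big1 // => w _; rewrite mul0r.
have U := av_gf_open_end (fun=> 1 : rat).
have UD := av_gf_open_end (fun n => n%:R : rat).
have V := av_gf_open_start (fun n => n%:R : rat).
rewrite -/count_gf -/D in U UD V.
set x := fpsX rat in U UD V *.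
set N := count_gf in U *.
set u := av_gf (fun=> 1) open_end in U *.
set ud := av_gf _ open_end in UD *; set v := av_gf _ open_start in V *.
move=> E.
have {}E : (1 + x) * D = x * ((1 + x) * D + D + N * N + D * N + N * D).
  have -> : x * ((1 + x) * D + D + N * N + D * N + N * D) =
    x * ((1 + x) * D + (1 + x) * v + (1 + x) * u * N + (1 + x) * ud * N
       + (1 + x) * u * D) by rewrite -V -U -UD.
  by rewrite [in LHS]E; ring.
have -> : x * N ^+ 2 = x * ((1 + x) * D + D + N * N + D * N + N * D)
   - x * (1 + x) * D - x * D - 2 * x * N * D by ring.
by rewrite -E; ring.
Qed.

(** * The closed form via the discriminant *)

Theorem corollary3p3 :
  let x : fps rat := fpsX rat in
  let S : fps rat := fps_sqrt (1 - 2 * x - 5 * x ^+ 2 - 2 * x ^+ 3 + x ^+ 4) in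
  let D : fps rat := descent_gf (fun a b : nat => a == b)
                                (fun a b : nat => (a >= b)%N) in
  2 * x * S * D = 1 - 2 * x - 3 * x ^+ 2 + x ^+ 4 - (1 - x - x ^+ 2) * S.
Proof.
move=> x S D.
pose p : fps rat := 1 - 2 * x - 5 * x ^+ 2 - 2 * x ^+ 3 + x ^+ 4.
(* Minus the derivative of the quadratic at its root [count_gf]; its square is therefore the
   discriminant. *)
pose s : fps rat := 1 - x - x ^+ 2 - 2 * x * count_gf.
have NE : x * count_gf ^+ 2 = (1 - x - x ^+ 2) * count_gf - x - x ^+ 2.
  exact: count_gf_eq.
have s0 : s 0%N = 1.
  (* The constant term 1 selects the branch of the square root. *)
  have -> : s = 1 - x * (1 + x + 2 * count_gf) by rewrite /s; ring.
  by rewrite fps_coefD fps_coefN fps_mulX_coef0 oppr0 addr0.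
have s2 : s ^+ 2 = p.
  have -> : s ^+ 2 = (1 - x - x ^+ 2) ^+ 2
    - 4 * x * ((1 - x - x ^+ 2) * count_gf - x * count_gf ^+ 2).
    by rewrite /s; ring.
  by rewrite NE /p; ring.
have p0 : p 0%N = 1 by rewrite -s2 expr2 fps_coefM big_ord1 s0 mulr1.
have [S0 S2] := fps_sqrtP p0.
have -> : S = s by apply: (fps_sqrt_unique S0 S2 s0 s2).
have sD : s * D = x * count_gf ^+ 2 by rewrite /D descent_gf_av descent_gf_eq.
have -> : 2 * x * s * D = 2 * x * (s * D) by ring.
(* The quadratic makes both sides linear in [count_gf], up to polynomial coefficients in [x]. *)
by rewrite sD NE /s; ring.
Qed.
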